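(* Let $H$ be a separable infinite-dimensional complex Hilbert space. The collection of $\ell^1$-bounded subsets of $H$ is closed under finite unions if and only if it is closed under finite sums, where the sum of two subsets $M, N \subseteq H$ is $M+N = \{x+y : x \in M,\ y \in N\}$.
   Context: A sequence $\{e_n\}_{n\in\mathbb{N}}$ in $H$ is a Riesz basis for $H$ if it is the image of an orthonormal basis under a bounded invertible linear operator. For a Riesz basis $\mathcal{E}=\{e_n\}$ and $x\in H$, put $\|x\|_{1,\mathcal{E}}=\sum_n |\langle x,e_n\rangle| \in [0,\infty]$. A subset $M\subseteq H$ is $\ell^1$-bounded (in $H$) if there exists a Riesz basis $\mathcal{E}$ for $H$ with $\sup_{x\in M}\|x\|_{1,\mathcal{E}}<\infty$. *)

(* Defs.v *)
From mathcomp Require Import all_boot all_order all_algebra.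
From mathcomp Require Import sesquilinear complex.
From mathcomp Require Import all_classical all_reals all_analysis.

Set Implicit Arguments.
Unset Strict Implicit.
Unset Printing Implicit Defensive.

Import Order.TTheory GRing.Theory Num.Theory.
Import numFieldNormedType.Exports.

Local Open Scope classical_set_scope.
Local Open Scope ring_scope.
Local Open Scope complex_scope.

(* A complex Hilbert space: the norm is the one induced by the inner product,
   which is linear in its first argument and conjugate-linear in the second. *)
Record hilbertSpace (R : realType) := HilbertSpace {
  hilbert_sort :> completeNormedModType R[i] ;
  inner : {dot hilbert_sort for Num.conj} ;
  norm_inner : forall x : hilbert_sort, `|x| ^+ 2 = inner x x
}.

Section HilbertSpace.
Variables (R : realType) (H : hilbertSpace R).

Definition separable_space : Prop := exists2 D : set H, countable D & dense D.

Definition infinite_dimensional : Prop :=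
  ~ exists n (v : 'I_n -> H),
      forall x : H, exists c : 'I_n -> R[i], x = \sum_(i < n) c i *: v i.

Definition orthonormal_seq (u : nat -> H) : Prop :=
  forall m n, inner H (u m) (u n) = (m == n)%:R.

Definition linear_span (u : nat -> H) : set H :=
  [set x | exists n (c : 'I_n -> R[i]), x = \sum_(i < n) c i *: u i].

Definition orthonormal_basis (u : nat -> H) : Prop :=
  orthonormal_seq u /\ dense (linear_span u).

Definition bounded_operator (T : H -> H) : Prop :=
  exists M : R, forall x : H, `|T x| <= M%:C * `|x|.

(* Invertible in the algebra of bounded operators: the inverse is bounded. *)
Definition invertible_operator (T : H -> H) : Prop :=
  exists S : {linear H -> H},
    [/\ bounded_operator S, cancel T S & cancel S T].

Definition riesz_basis (e : nat -> H) : Prop :=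
  exists u : nat -> H, exists T : {linear H -> H},
    [/\ orthonormal_basis u, bounded_operator T, invertible_operator T
      & forall n, e n = T (u n)].

(* In R[i] the modulus is again a complex number, hence the real part. *)
Definition l1_norm (e : nat -> H) (x : H) : \bar R :=
  (\sum_(0 <= n <oo) (complex.Re `|inner H x (e n)|)%:E)%E.

Definition l1_bounded (M : set H) : Prop :=
  exists2 e : nat -> H, riesz_basis e &
    (ereal_sup [set l1_norm e x | x in M] < +oo)%E.

Definition set_add (M N : set H) : set H := [set x + y | x in M & y in N].

(* Finite families include the empty one: its union is the empty set and its
   sum is {0}. *)
Definition closed_finite_unions (P : set H -> Prop) : Prop :=
  forall n (M : 'I_n -> set H), (forall i, P (M i)) ->
    P (\big[setU/set0]_(i < n) M i).

Definition closed_finite_sums (P : set H -> Prop) : Prop :=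
  forall n (M : 'I_n -> set H), (forall i, P (M i)) ->
    P (\big[set_add/[set 0]]_(i < n) M i).

End HilbertSpace.

(* Main.v *)
Require Import Defs.
From mathcomp Require Import all_boot all_order all_algebra.
From mathcomp Require Import all_classical all_reals all_analysis.
From mathcomp Require Import sesquilinear complex.

Import Order.TTheory GRing.Theory Num.Theory.

Local Open Scope classical_set_scope.
Local Open Scope ring_scope.

(** For a fixed sequence [e], the quantity [l1_norm e] is an extended-valued
    seminorm, so the sets on which it is bounded are stable under subsets,
    adjunction of [0] and sums.

    If finite unions of l1-bounded sets are l1-bounded, then a finite family of
    such sets is bounded with respect to one common Riesz basis (that of the
    union), and the triangle inequality bounds the sum in that same basis.
    The converse rests on the inclusion of the union of the [M i] in the sum of
    the sets [M i `|` [set 0]]: adjoining [0] to a set keeps it bounded in the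
    same basis, and an element of one [M i] is its own sum with zeros.

    The existence of a Riesz basis is never needed on its own: the empty family
    provides one on either side of the equivalence. *)

Section L1Norm.
Context {R : realType} {H : hilbertSpace R}.
Implicit Types (e : nat -> H) (x y : H) (A B : set H).

Lemma Re_normr_ge0 (z : R[i]) : 0 <= complex.Re `|z|.
Proof. by have := normr_ge0 z; rewrite lecE => /andP[]. Qed.

Lemma l1_norm0 e : l1_norm e 0 = 0%E.
Proof.
rewrite /l1_norm; apply: eseries0 => n _ _.
by rewrite linear0l normr0.
Qed.

Lemma l1_normD e x y : (l1_norm e (x + y)%R <= l1_norm e x + l1_norm e y)%E.
Proof.
rewrite /l1_norm -nneseriesD; first last.
- by move=> n _ _; rewrite lee_fin Re_normr_ge0.
- by move=> n _ _; rewrite lee_fin Re_normr_ge0.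
apply: lee_nneseries => n _; first by rewrite lee_fin Re_normr_ge0.
rewrite -EFinD lee_fin linearDl.
have := ler_normD (inner H x (e n)) (inner H y (e n)).
by rewrite lecE raddfD => /andP[].
Qed.

(** [A] is bounded for the seminorm attached to the sequence [e], with an
    explicit real bound in place of the finiteness of a supremum. *)
Definition l1_bounded_wrt e A :=
  exists C : R, forall x, A x -> (l1_norm e x <= C%:E)%E.

Lemma l1_bounded_wrtP A :
  l1_bounded A <-> exists2 e, riesz_basis e & l1_bounded_wrt e A.
Proof.
split=> -[e be].
- move=> supA; exists e => //.
  have ub x : A x -> (l1_norm e x <= ereal_sup [set l1_norm e x | x in A])%E.
    by move=> Ax; apply: ereal_sup_ubound; exists x.
  move: supA ub; case: (ereal_sup _) => [C _ ub|//|_ ub]; first by exists C.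
  (* the supremum is -oo only if A is empty; any real number is then a bound *)
  by exists 0 => x /ub; rewrite leeNy_eq => /eqP ->; rewrite leNye.
- case=> C ub; exists e => //; apply: (@le_lt_trans _ _ C%:E); last exact: ltry.
  by apply: ge_ereal_sup => _ [x Ax <-]; apply: ub.
Qed.

Lemma l1_bounded_wrt_sub e A B :
  A `<=` B -> l1_bounded_wrt e B -> l1_bounded_wrt e A.
Proof. by move=> AB [C ub]; exists C => x /AB; apply: ub. Qed.

Lemma l1_bounded_wrt0 e : l1_bounded_wrt e [set 0].
Proof. by exists 0 => _ ->; rewrite l1_norm0. Qed.

Lemma l1_bounded_wrtU e A B :
  l1_bounded_wrt e A -> l1_bounded_wrt e B -> l1_bounded_wrt e (A `|` B).
Proof.
move=> [C ubA] [D ubB]; exists (Num.max C D) => x [/ubA|/ubB] le_x;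
  by apply: (le_trans le_x); rewrite lee_fin le_max lexx ?orbT.
Qed.

Lemma l1_bounded_wrtD e A B :
  l1_bounded_wrt e A -> l1_bounded_wrt e B -> l1_bounded_wrt e (set_add A B).
Proof.
move=> [C ubA] [D ubB]; exists (C + D) => _ [x Ax [y By <-]].
by apply: (le_trans (l1_normD e x y)); rewrite EFinD leeD ?ubA ?ubB.
Qed.

Lemma l1_bounded_sub A B : A `<=` B -> l1_bounded B -> l1_bounded A.
Proof.
move=> AB /l1_bounded_wrtP[e be bB]; apply/l1_bounded_wrtP; exists e => //.
exact: l1_bounded_wrt_sub bB.
Qed.

Lemma l1_bounded_adjoin0 A : l1_bounded A -> l1_bounded (A `|` [set 0]).
Proof.
move=> /l1_bounded_wrtP[e be bA]; apply/l1_bounded_wrtP; exists e => //.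
exact: l1_bounded_wrtU bA (l1_bounded_wrt0 e).
Qed.

Lemma bigsetU_sub_set_add n (M : 'I_n -> set H) :
  \big[setU/set0]_(i < n) M i
    `<=` \big[@set_add R H/[set 0]]_(i < n) (M i `|` [set 0]).
Proof.
(* for the induction, the sum is also required to contain 0 *)
suff [] : \big[setU/set0]_(i < n) M i
    `<=` \big[@set_add R H/[set 0]]_(i < n) (M i `|` [set 0])
  /\ (\big[@set_add R H/[set 0]]_(i < n) (M i `|` [set 0])) 0 by [].
elim/big_rec2: _ => [|i S U _ [US S0]]; first by split.
split; last by exists 0; [right|exists 0; rewrite ?addr0].
move=> x [Mx|/US Sx].
- by exists x; [left|exists 0; rewrite ?addr0].
- by exists 0; [right|exists x; rewrite ?add0r].
Qed.

End L1Norm.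

Theorem lemma4p11 (R : realType) (H : hilbertSpace R)
    (Hsep : separable_space H) (Hinf : infinite_dimensional H) :
  closed_finite_unions (@l1_bounded R H) <-> closed_finite_sums (@l1_bounded R H).
Proof.
split=> closedP n M bM.
- have /l1_bounded_wrtP[e be bU] := closedP n M bM.
  apply/l1_bounded_wrtP; exists e => //.
  apply: big_ind => [|A B|i _]; first exact: l1_bounded_wrt0.
    exact: l1_bounded_wrtD.
  by apply: l1_bounded_wrt_sub bU; rewrite (bigD1 i) //=; exact: subsetUl.
- apply: (l1_bounded_sub _ _ (bigsetU_sub_set_add n M)).
  by apply: closedP => i; apply: l1_bounded_adjoin0.
Qed.
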